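(* Let $\sigma\in\mathcal{W}_{2,ac}(\mathbb{R}^n)$, $\mu\in\mathcal{W}_2(\mathbb{R}^n)$, $P\in O(n)$ and $T\in\mathfrak{S}(P)$. Then $$\mathcal{U}(T_\sharp\sigma,\mu,P)=\mathcal{U}(\sigma,\mu,P)\qquad\text{(whenever } T_\sharp\sigma\in\mathcal{W}_{2,ac}(\mathbb{R}^n)\text{)},$$ $$\mathcal{U}(\sigma,T_\sharp\mu,P)=T_\sharp\,\mathcal{U}(\sigma,\mu,P)\qquad\text{(whenever } T_\sharp\mu\in\mathcal{W}_2(\mathbb{R}^n)\text{)}.$$
   Context: $\mathcal{W}_2(\mathbb{R}^n)$ is the set of Borel probability measures on $\mathbb{R}^n$ with finite second moment, and $\mathcal{W}_{2,ac}(\mathbb{R}^n)$ the subset of those absolutely continuous with respect to Lebesgue measure. $\sharp$ denotes pushforward. For $P=[\theta_1,\ldots,\theta_n]\in O(n)$ (orthogonal matrix with columns $\theta_i$), the set of $P$-compatible maps is $\mathfrak{S}(P)=\{x\mapsto\sum_{i=1}^nf_i(x\cdot\theta_i)\theta_i:\ f_i:\mathbb{R}\to\mathbb{R}\text{ increasing}\}$, where increasing means $s\le t\Rightarrow f_i(s)\le f_i(t)$. For $\theta\in S^{n-1}$, $\sigma^\theta$ is the pushforward of $\sigma$ under $x\mapsto x\cdot\theta$. For one-dimensional measures $\alpha$ (absolutely continuous) and $\beta$, $T_\alpha^\beta=F_\beta^{-1}\circ F_\alpha$ is the optimal transport map ($F_\alpha$ the cumulative distribution function, $F_\beta^{-1}$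 the quantile function), i.e. the $\alpha$-a.e. unique nondecreasing map pushing $\alpha$ to $\beta$. $T_{\sigma,\mu;P}(x)=\sum_{i=1}^nT_{\sigma^{\theta_i}}^{\mu^{\theta_i}}(x\cdot\theta_i)\,\theta_i$. The slice-matching operator is $\mathcal{U}:\mathcal{W}_{2,ac}(\mathbb{R}^n)\times\mathcal{W}_2(\mathbb{R}^n)\times O(n)\to\mathcal{W}_2(\mathbb{R}^n)$, $\mathcal{U}(\sigma,\mu,P)=(T_{\sigma,\mu;P})_\sharp\sigma$. *)

(* Defs.v *)
From HB Require Import structures.
From mathcomp Require Import all_boot all_order all_algebra.
From mathcomp Require Import all_classical all_reals all_analysis.
From mathcomp Require Import measurable_realfun.

Set Implicit Arguments.
Unset Strict Implicit.
Unset Printing Implicit Defensive.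

Import Order.TTheory GRing.Theory Num.Theory.
Import numFieldNormedType.Exports.

Local Open Scope classical_set_scope.
Local Open Scope ring_scope.

(* Borel sigma-algebra on matrices; R^n is 'cV[R]_n throughout. *)
HB.instance Definition _ (R : realType) (m n : nat) :=
  @isMeasurable.Build (sigma_display (@open 'M[R]_(m, n)))
    'M[R]_(m, n) <<s @open 'M[R]_(m, n) >>
    (@sigma_algebra0 _ setT _) (@sigma_algebraC _ _)
    (@sigma_algebra_bigcup _ setT _).

Definition dotv (R : realType) (n : nat) (x y : 'cV[R]_n) : R :=
  \sum_(i < n) x i ord0 * y i ord0.

(* Lebesgue measure on R^n as the n-fold product of the one on R: R^(n+1) is
   identified with R * R^n by stacking the first coordinate on the others. *)
Fixpoint lebesgue_cV (R : realType) (n : nat) : set 'cV[R]_n -> \bar R :=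
  match n with
  | 0 => dirac (0 : 'cV[R]_0)
  | n'.+1 => pushforward (@lebesgue_measure R \x @lebesgue_cV R n')%E
      (fun p : R * 'cV[R]_n' => col_mx (p.1)%:M p.2 : 'cV[R]_n'.+1)
  end.

Lemma lebesgue_cV_box (R : realType) (n : nat) (a b : 'cV[R]_n) :
  (forall i, a i ord0 <= b i ord0) ->
  lebesgue_cV [set x : 'cV[R]_n | forall i, a i ord0 < x i ord0 <= b i ord0] =
  (\prod_(i < n) (b i ord0 - a i ord0))%:E.
Proof.
elim: n a b => [|n IH] a b ab.
  by rewrite big_ord0 /= diracE mem_set//= => -[].
rewrite /= /pushforward /product_measure1 big_ord_recl.
set c := (\prod_(i < n) _).
have E0 (x : R) (y : 'cV[R]_n) : (col_mx (x%:M : 'cV[R]_1) y : 'cV[R]_n.+1) ord0 ord0 = x.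
  have -> : ord0 = lshift n (ord0 : 'I_1) by apply: val_inj.
  by rewrite (@col_mxEu R 1 n 1) mxE eqxx.
have ES (x : R) (y : 'cV[R]_n) i :
    (col_mx (x%:M : 'cV[R]_1) y : 'cV[R]_n.+1) (lift ord0 i) ord0 = y i ord0.
  have -> : lift ord0 i = rshift 1 i by apply: val_inj.
  by rewrite (@col_mxEd R 1 n 1).
transitivity (\int[lebesgue_measure]_x
   (c%:E * (\1_(`]a ord0 ord0, b ord0 ord0]%classic : set R) x)%:E))%E; last first.
  rewrite ge0_integralZl//=; last 2 first.
  - by apply/measurable_EFinP; exact: measurable_indic.
  - by rewrite lee_fin; apply: prodr_ge0 => i _; rewrite subr_ge0.
  rewrite integral_indic//= setIT lebesgue_measure_itv/= lte_fin.
  case: ifPn => [_|]; first by rewrite -EFinB -EFinM mulrC.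
  rewrite -leNgt => ba; rewrite mule0.
  rewrite (_ : b ord0 ord0 - a ord0 ord0 = 0) ?mul0r//.
  by apply/eqP; rewrite subr_eq0 eq_le ba ab.
apply: eq_integral => x _ /=.
rewrite indicE; case: (boolP (x \in _)) => [|] /=.
  rewrite inE/= in_itv/= mule1 => axb.
  have -> : c = \prod_(i < n) ((\col_i b (lift ord0 i) ord0) i ord0 -
      (\col_i a (lift ord0 i) ord0) i ord0).
    by apply: eq_bigr => i _; rewrite !mxE.
  rewrite -IH; last by move=> i; rewrite !mxE.
  congr lebesgue_cV; apply/seteqP; split => y; rewrite /xsection/= inE/=.
    by move=> + i => /(_ (lift ord0 i)); rewrite ES !mxE.
  move=> + i; case: (unliftP ord0 i) => [j ->|->]; last by rewrite E0.
  by move=> /(_ j); rewrite ES !mxE.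
rewrite notin_setE/= in_itv/= mule0 => axb.
rewrite (_ : xsection _ _ = set0).
  elim: {+}n => [|m IHm] /=; first by rewrite diracE memNset.
  rewrite /pushforward /product_measure1 integral0_eq// => z _.
  by rewrite preimage_set0 /= xsection0.
rewrite -subset0 => y; rewrite /xsection/= inE/= => /(_ ord0).
by rewrite E0.
Qed.

Definition second_moment (R : realType) (n : nat) (m : set 'cV[R]_n -> \bar R) :
    \bar R :=
  (\int[m]_x (dotv x x)%:E)%E.

Definition W2 (R : realType) (n : nat) : set (set 'cV[R]_n -> \bar R) :=
  [set m : set 'cV[R]_n -> \bar R |
    (exists p : probability 'cV[R]_n R, m = p :> (set 'cV[R]_n -> \bar R)) /\
    (second_moment m < +oo)%E].

Definition W2ac (R : realType) (n : nat) : set (set 'cV[R]_n -> \bar R) :=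
  [set m | W2 m /\ m `<< @lebesgue_cV R n].

Definition orthogonal_group (R : realType) (n : nat) : set 'M[R]_n :=
  [set P | P^T *m P = 1%:M].

Definition separable_map (R : realType) (n : nat) (P : 'M[R]_n)
    (f : 'I_n -> R -> R) (x : 'cV[R]_n) : 'cV[R]_n :=
  \sum_(i < n) f i (dotv x (col i P)) *: col i P.

Definition compatible_maps (R : realType) (n : nat) (P : 'M[R]_n) :
    set ('cV[R]_n -> 'cV[R]_n) :=
  [set separable_map P f | f in
     [set f | forall i, {homo f i : s t / s <= t}]].

Definition slice (R : realType) (n : nat) (theta : 'cV[R]_n)
    (m : set 'cV[R]_n -> \bar R) : set R -> \bar R :=
  pushforward m (fun x => dotv x theta).

(* [cdf] of the library takes a random variable; this one takes its law. *)
Definition law_cdf (R : realType) (alpha : set R -> \bar R) (t : R) : R :=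
  fine (alpha `]-oo, t]%classic).

(* At levels outside ]0, 1[ the set below can be empty or unbounded, where
   [inf] is 0. When alpha has no atoms, [law_cdf alpha] takes its values in
   ]0, 1[ alpha-almost everywhere, so [ot_map] is F_beta^-1 \o F_alpha
   alpha-almost everywhere. *)
Definition quantile (R : realType) (beta : set R -> \bar R) (u : R) : R :=
  inf [set t | u <= law_cdf beta t].

Definition ot_map (R : realType) (alpha beta : set R -> \bar R) : R -> R :=
  quantile beta \o law_cdf alpha.

Definition slice_matching_map (R : realType) (n : nat)
    (sigma mu : set 'cV[R]_n -> \bar R) (P : 'M[R]_n) : 'cV[R]_n -> 'cV[R]_n :=
  separable_map P
    (fun i => ot_map (slice (col i P) sigma) (slice (col i P) mu)).

Definition slice_matching (R : realType) (n : nat)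
    (sigma mu : set 'cV[R]_n -> \bar R) (P : 'M[R]_n) : set 'cV[R]_n -> \bar R :=
  pushforward sigma (slice_matching_map sigma mu P).

(* Measures are functions on all sets, so equality of two Borel measures is
   equality on Borel sets. *)
Definition eq_borel (R : realType) (n : nat) (m1 m2 : set 'cV[R]_n -> \bar R) :
    Prop :=
  forall A : set 'cV[R]_n, measurable A -> m1 A = m2 A.

(* Main.v *)
Require Import Defs.
From HB Require Import structures.
From mathcomp Require Import all_boot all_order all_algebra.
From mathcomp Require Import all_classical all_reals all_analysis.
From mathcomp Require Import measurable_realfun.

(* Write F_a for the cumulative distribution function and Q_a for the quantile
   function of a measure a on the line. Since P is orthogonal, the i-th slice of
   (sum_i f_i(x . theta_i) theta_i)_# m is the pushforward by f_i of the i-th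
   slice of m, so both identities reduce to statements about nondecreasing maps
   of the line. Hyperplanes are Lebesgue null, hence slices of absolutely
   continuous measures have no atoms.
   First identity: if f_# a has no atom, then F_{f_# a}(f s) = F_a(s) for every
   s, so the two slice-matching maps satisfy S' o T = S everywhere.
   Second identity: Q_{f_# b}(u) = f(Q_b(u)) for all u in ]0, 1[ outside the
   countable set F_{f_# b}(rationals), and the level sets of F_a are null when a
   has no atoms, so the two slice-matching maps agree sigma-almost everywhere. *)

Set Implicit Arguments.
Unset Strict Implicit.
Unset Printing Implicit Defensive.

Import Order.TTheory GRing.Theory Num.Theory.
Import numFieldNormedType.Exports.

Local Open Scope classical_set_scope.
Local Open Scope ring_scope.

(** * Measurability of maps into R^n *)

Lemma measurable_coord (R : realType) (n : nat) (i : 'I_n) :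
  measurable_fun setT (fun x : 'cV[R]_n => x i ord0).
Proof.
apply: (measurability (@RGenOpens.G R)) => [|_ [_ [a [b ->]] <-]].
  exact: RGenOpens.measurableE.
rewrite setTI; apply: sub_sigma_algebra.
apply: open_comp; last exact: itv_open.
by move=> x _; exact: coord_continuous.
Qed.

(** Balls are taken for the sup norm, so the preimage of a ball is a finite intersection of
    coordinate preimages; an open set is the countable union of the balls inside it with rational
    centre and radius 1/(k+1). *)
Lemma measurable_fun_cV d (T : measurableType d) (R : realType) (n : nat)
    (f : T -> 'cV[R]_n) :
  (forall i, measurable_fun setT (fun x => f x i ord0)) -> measurable_fun setT f.
Proof.
move=> mf; apply: (measurability (@open 'cV[R]_n)) => // _ [U oU <-].
rewrite setTI.
pose ratc (q : 'cV[rat]_n) : 'cV[R]_n := map_mx ratr q.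
pose D := [set qk : 'cV[rat]_n * nat | ball (ratc qk.1) qk.2.+1%:R^-1 `<=` U].
have -> : f @^-1` U =
    \bigcup_(qk in D) (f @^-1` ball (ratc qk.1) qk.2.+1%:R^-1).
  apply/seteqP; split => [x /= Ux|x [qk /= Dqk fx]]; last exact: Dqk.
  have /nbhs_ballP[e /= e0 eU] : nbhs (f x) U by exact: open_nbhs_nbhs.
  have [k k0] : exists k : nat, k.+1%:R^-1 < e / 2.
    have := @near_infty_natSinv_lt R (PosNum (divr_gt0 e0 (ltr0n R 2))).
    by move=> [k _ kP]; exists k; apply: kP => /=.
  have k10 : 0 < k.+1%:R^-1 :> R by rewrite invr_gt0.
  have /(_ _)/cid qP i : exists q : rat, ball (f x i ord0) k.+1%:R^-1 (ratr q).
    have /rat_in_itvoo[q] :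
        f x i ord0 - k.+1%:R^-1 < f x i ord0 + k.+1%:R^-1.
      by rewrite ltrBlDr -addrA ltrDl addr_gt0.
    by move=> qx; exists q; rewrite ball_itv.
  pose q : 'cV[rat]_n := \col_i sval (qP i).
  have fxq : ball (ratc q) k.+1%:R^-1 (f x).
    split=> // i j; rewrite !mxE (ord1 j); apply: ball_sym.
    exact: (svalP (qP i)).
  exists (q, k) => //= y qy; apply: eU.
  apply: (@le_ball _ _ _ (k.+1%:R^-1 + k.+1%:R^-1)).
    by rewrite [leRHS]splitr lerD// ltW.
  by apply: ball_triangle qy; exact: ball_sym.
rewrite bigcup_mkcond; apply: countable_bigcupT_measurable => [//|[q k]].
case: ifPn => // _.
have -> : f @^-1` ball (ratc q) k.+1%:R^-1 =
    \bigcap_i ((fun x => f x i ord0) @^-1`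
      ball (ratc q i ord0) k.+1%:R^-1).
  apply/seteqP; split => [x [_ fx] i _ /=|x fx]; first exact: fx.
  by split=> [|i j]; rewrite ?invr_gt0// (ord1 j); exact: fx.
apply: fin_bigcap_measurable => // i _; rewrite -[X in measurable X]setTI.
by apply: mf => //; rewrite ball_itv.
Qed.

Lemma measurable_dotv (R : realType) (n : nat) (theta : 'cV[R]_n) :
  measurable_fun setT (fun x => dotv x theta).
Proof.
apply: measurable_sum => i; apply: measurable_funM => //.
exact: measurable_coord.
Qed.

Lemma measurable_separable_map (R : realType) (n : nat) (P : 'M[R]_n)
    (f : 'I_n -> R -> R) :
  (forall i, measurable_fun setT (f i)) -> measurable_fun setT (separable_map P f).
Proof.
move=> mf; apply: measurable_fun_cV => j.
under eq_fun do rewrite summxE.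
apply: measurable_sum => i.
under eq_fun do rewrite mxE.
apply: measurable_funM => //; apply: measurableT_comp => //.
exact: measurable_dotv.
Qed.

(** * Separable maps in an orthonormal basis *)

Lemma dotv_separable_map (R : realType) (n : nat) (P : 'M[R]_n)
    (f : 'I_n -> R -> R) (x : 'cV[R]_n) (i : 'I_n) :
  orthogonal_group P ->
  dotv (separable_map P f x) (col i P) = f i (dotv x (col i P)).
Proof.
move=> PP.
have PE j : dotv (col j P) (col i P) = (j == i)%:R.
  have /matrixP/(_ j i) := PP; rewrite !mxE => <-.
  by apply: eq_bigr => k _; rewrite !mxE.
transitivity (\sum_j f j (dotv x (col j P)) * dotv (col j P) (col i P)).
  rewrite /dotv; under [RHS]eq_bigr do rewrite mulr_sumr.
  rewrite exchange_big/=; apply: eq_bigr => k _.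
  rewrite summxE mulr_suml; apply: eq_bigr => j _.
  by rewrite mxE mulrA.
rewrite (bigD1 i)//= PE eqxx mulr1 big1 ?addr0// => j ji.
by rewrite PE (negbTE ji) mulr0.
Qed.

Lemma separable_map_comp (R : realType) (n : nat) (P : 'M[R]_n)
    (f g : 'I_n -> R -> R) (x : 'cV[R]_n) :
  orthogonal_group P ->
  separable_map P f (separable_map P g x) = separable_map P (fun i => f i \o g i) x.
Proof.
by move=> PP; apply: eq_bigr => i _; rewrite dotv_separable_map.
Qed.

(** * Null hyperplanes and slices of measures *)

Lemma lebesgue_cV0 (R : realType) (n : nat) : lebesgue_cV (@set0 'cV[R]_n) = 0%E.
Proof.
elim: n => [|n IHn] /=; first by rewrite diracE memNset.
rewrite /pushforward /product_measure1 integral0_eq// => z _.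
by rewrite preimage_set0 /= xsection0.
Qed.

(* [A] is not assumed measurable: null sets for [`<<] are tested on subsets, and
   the induction applies the statement to sections of [A]. *)
Lemma lebesgue_cV_hyperplane (R : realType) (n : nat) (theta : 'cV[R]_n) (c : R)
    (A : set 'cV[R]_n) :
  theta != 0 -> A `<=` [set x | dotv x theta = c] -> lebesgue_cV A = 0%E.
Proof.
elim: n theta c A => [|n IH] theta c A theta0 Ac.
  by move: theta0; rewrite [theta]flatmx0 eqxx.
rewrite /= /pushforward /product_measure1.
pose theta1 : R := theta ord0 ord0.
pose theta' : 'cV[R]_n := \col_i theta (lift ord0 i) ord0.
have AE x y : A (col_mx (x%:M : 'cV[R]_1) y : 'cV[R]_n.+1) ->
    x * theta1 + dotv y theta' = c.
  move=> /Ac/= <-; rewrite /dotv big_ord_recl; congr (_ * _ + _).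
    have -> : ord0 = lshift n (ord0 : 'I_1) by apply: val_inj.
    by rewrite (@col_mxEu R 1 n 1) mxE eqxx.
  apply: eq_bigr => i _; rewrite mxE.
  have -> : lift ord0 i = rshift 1 i by apply: val_inj.
  by rewrite (@col_mxEd R 1 n 1).
(* If [theta'] is nonzero, every section of [A] lies in a hyperplane one dimension lower; otherwise
   the equation pins the first coordinate to [c / theta1]. *)
have [theta'0|theta'0] := eqVneq theta' 0; last first.
  apply: integral0_eq => x _ /=.
  apply: (IH theta' (c - x * theta1)) => // y; rewrite /xsection/= inE/= => /AE <-.
  by rewrite addrC addKr.
have theta10 : theta1 != 0.
  apply: contra_neq theta0 => theta10; apply/matrixP => i j.
  rewrite mxE (ord1 j); case: (unliftP ord0 i) => [k ->|->//].
  by have /matrixP/(_ k ord0) := theta'0; rewrite !mxE.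
set g := (X in integral _ _ X).
have g0 x : x != c / theta1 -> g x = 0%E.
  move=> xc; rewrite /g /= (_ : xsection _ _ = set0) ?lebesgue_cV0//.
  rewrite -subset0 => y; rewrite /xsection/= inE/= => /AE.
  rewrite theta'0 /dotv big1 ?addr0; last by move=> i _; rewrite mxE mulr0.
  by move=> xE; move: xc; rewrite -xE mulfK// eqxx.
(* As [A] is arbitrary, [g] is not known to be measurable; on a singleton its measurability is
   automatic. *)
have -> : (\int[lebesgue_measure]_x g x =
    \int[lebesgue_measure]_(x in [set (c / theta1)%R]) g x)%E.
  rewrite [RHS]integral_mkcond; apply: eq_integral => x _.
  rewrite patchE; case: ifPn => //; rewrite notin_setE => /= /eqP; exact: g0.
apply: null_set_integral => //; first exact: measurable_fun_set1.
exact: lebesgue_measure_set1.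
Qed.

Lemma slice_set1 (R : realType) (n : nat) (theta : 'cV[R]_n)
    (m : set 'cV[R]_n -> \bar R) (c : R) :
  m `<< @lebesgue_cV R n -> theta != 0 -> slice theta m [set c] = 0%E.
Proof.
move=> mac theta0.
have mH : measurable [set x | dotv x theta = c].
  rewrite -[X in measurable X]setTI.
  exact: (@measurable_dotv R n theta measurableT _ (measurable_set1 c)).
apply: (mac [set x | dotv x theta = c] _ _ mH) => // A mA Ac.
exact: lebesgue_cV_hyperplane Ac.
Qed.

Lemma col_orthogonal_neq0 (R : realType) (n : nat) (P : 'M[R]_n) (i : 'I_n) :
  orthogonal_group P -> col i P != 0.
Proof.
move=> /matrixP/(_ i i); rewrite !mxE eqxx; apply: contra_eq_neq => /matrixP Pi0.
rewrite big1 1?eq_sym ?oner_neq0// => k _.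
by have := Pi0 k ord0; rewrite !mxE => ->; rewrite mulr0.
Qed.

Lemma slice_pushforward (R : realType) (n : nat) (m : set 'cV[R]_n -> \bar R)
    (P : 'M[R]_n) (f : 'I_n -> R -> R) (i : 'I_n) :
  orthogonal_group P ->
  slice (col i P) (pushforward m (separable_map P f)) =
  pushforward (slice (col i P) m) (f i).
Proof.
move=> PP; apply/funext => A; rewrite /slice /pushforward; congr m.
by apply/seteqP; split => x /=; rewrite dotv_separable_map.
Qed.

(** Slices and pushforwards are bare set functions; this bundles them as probabilities, so that the
    results on the line apply to them. *)
Lemma pushforward_probability d d' (T : measurableType d) (T' : measurableType d')
    (R : realType) (p : probability T R) (f : T -> T') :
  measurable_fun setT f ->
  exists q : probability T' R, pushforward p f = q :> (set T' -> \bar R).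
Proof.
move=> mf; pose F : {mfun T >-> T'} := HB.pack f (@isMeasurableFun.Build _ _ _ _ f mf).
by exists (distribution p F).
Qed.

(** * Distribution and quantile functions on the line *)

Section law_cdf.
Context (R : realType) (b : probability R R).

(** Under [b] the identity is a random variable with law [b], so facts about [cdf] transfer to
    [law_cdf b]. *)
Let idR : R -> R := idfun.
#[local] HB.instance Definition _ :=
  @isMeasurableFun.Build _ _ _ _ idR (@measurable_id _ _ setT).

Lemma law_cdfE t : (law_cdf b t)%:E = b `]-oo, t]%classic.
Proof. by rewrite /law_cdf fineK// fin_num_measure. Qed.

Let law_cdf_cdf t : (law_cdf b t)%:E = cdf (idR : {RV b >-> R}) t.
Proof. by rewrite law_cdfE. Qed.

Lemma law_cdf_nondecreasing : nondecreasing_fun (law_cdf b).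
Proof. by move=> s t st; rewrite -lee_fin !law_cdf_cdf cdf_nondecreasing. Qed.

Lemma law_cdf_ge0 t : 0 <= law_cdf b t.
Proof. by rewrite -lee_fin law_cdfE. Qed.

Lemma law_cdf_le1 t : law_cdf b t <= 1.
Proof. by rewrite -lee_fin law_cdfE probability_le1. Qed.

Lemma measurable_law_cdf : measurable_fun setT (law_cdf b).
Proof. exact: nondecreasing_measurable law_cdf_nondecreasing. Qed.

(** For levels in ]0, 1[ the limits 0 and 1 of the distribution function make the defining set
    nonempty and bounded below, and right-continuity puts its infimum in it. *)
Lemma quantile_galois (u t : R) :
  0 < u < 1 -> (quantile b u <= t) = (u <= law_cdf b t).
Proof.
move=> /andP[u0 u1]; set S := [set t | u <= law_cdf b t].
have [s Ss] : S !=set0.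
  have Fy : law_cdf b @ +oo --> (1 : R)
    by exact/fine_cvg/(cvg_cdfy1 (idR : {RV b >-> R})).
  have [s us] := filter_ex (cvgr_gt 1 Fy u u1).
  by exists s; exact: ltW.
have [l Sl] : has_lbound S.
  have FNy : law_cdf b @ -oo --> (0 : R)
    by exact/fine_cvg/(cvg_cdfNy0 (idR : {RV b >-> R})).
  have [l ul] := filter_ex (cvgr_lt 0 FNy u u0).
  exists l => r /= ur; rewrite leNgt; apply/negP => rl.
  move: ul; rewrite ltNge => /negP; apply.
  by rewrite (le_trans ur)// law_cdf_nondecreasing// ltW.
have infS : has_inf S by split; [exists s|exists l].
apply/idP/idP => [qt|]; last by move=> ut; apply: ge_inf => //; exists l.
apply: (@le_trans _ _ (law_cdf b (quantile b u))); last exact: law_cdf_nondecreasing.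
rewrite -lee_fin law_cdf_cdf.
apply: (cvge_to_ge (@cdf_right_continuous _ _ _ _ (idR : {RV b >-> R}) _)).
near=> r; rewrite -law_cdf_cdf lee_fin.
have qr : 0 < r - quantile b u by rewrite subr_gt0; near: r; exact: nbhs_right_gt.
have [v Sv] := inf_adherent qr infS.
by rewrite -/(quantile b u) subrKC => /ltW/law_cdf_nondecreasing; apply: le_trans.
Unshelve. all: by end_near. Qed.

Lemma quantile_le0 (u : R) : u <= 0 -> quantile b u = 0.
Proof.
move=> u0; rewrite /quantile inf_out// => -[_ [l]] /(_ (l - 1)) /=.
by rewrite (le_trans u0 (law_cdf_ge0 _)) => /(_ isT); rewrite lerBrDr gerDl ler10.
Qed.

Lemma quantile_gt1 (u : R) : 1 < u -> quantile b u = 0.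
Proof.
move=> u1; rewrite /quantile (_ : mkset _ = set0) ?inf0//.
rewrite -subset0 => t /= /le_trans/(_ (law_cdf_le1 _)).
by rewrite leNgt u1.
Qed.

(** The default value 0 outside ]0, 1] can break monotonicity, so the line is split: on ]0, 1[ the
    Galois property turns superlevel sets into rays, level 1 is a single point, and the function is
    0 elsewhere. *)
Lemma measurable_quantile : measurable_fun setT (quantile b).
Proof.
have -> : [set: R] = `]0, 1[ `|` ([set 1] `|` ~` (`]0, 1[ `|` [set 1])).
  by rewrite setUA setUv.
apply/measurable_funU => //.
  by apply: measurableU => //; apply: measurableC; exact: measurableU.
split; last first.
  apply/measurable_funU => //; first by apply: measurableC; exact: measurableU.
  split; first exact: measurable_fun_set1.
  apply: (eq_measurable_fun (cst (0:R))) => [u|]; last exact: measurable_cst.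
  rewrite inE/= in_itv/= => /not_orP[/negP + u1].
  rewrite negb_and -!leNgt => /orP[u0|u1']; first by rewrite quantile_le0.
  by rewrite quantile_gt1// lt_neqAle u1' andbT eq_sym; apply/eqP.
move=> m01; apply: (measurability (@RGenOInfty.G R)) => //.
  exact: RGenOInfty.measurableE.
move=> _ [_ [t ->] <-].
rewrite (_ : _ `&` _ = `]0, 1[ `&` `]law_cdf b t, +oo[); first exact: measurableI.
apply/seteqP; split => u /= []; rewrite !in_itv/= !andbT => u01 ut; split => //.
  by move: ut; rewrite ltNge quantile_galois// -ltNge.
by rewrite ltNge quantile_galois// -ltNge.
Qed.

(** Continuity from below. [quantile_pushforward] applies it at [q = quantile b u], below which the
    distribution function is less than [u]. *)
Lemma measure_itvNyo_le (q u : R) :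
  (forall s, s < q -> law_cdf b s <= u) -> (b `]-oo, q[%classic <= u%:E)%E.
Proof.
move=> bu; have -> : `]-oo, q[%classic = \bigcup_n `]-oo, q - n.+1%:R^-1]%classic.
  apply/seteqP; split => [s|s [n _]] /=; rewrite !in_itv/=.
    by move=> /ltr_add_invr[n sn]; exists n => //=; rewrite in_itv/= lerBrDr ltW.
  by move=> /le_lt_trans; apply; rewrite ltrBlDr ltrDl invr_gt0.
have : b `]-oo, q - n.+1%:R^-1]%classic @[n --> \oo] -->
    b (\bigcup_n `]-oo, q - n.+1%:R^-1]%classic).
  apply: nondecreasing_cvg_mu => //; first exact: bigcup_measurable.
  move=> m n mn; apply/subsetPset; apply: subset_itvl.
  by rewrite bnd_simp lerD2l lerN2 lef_pV2 ?posrE// ler_nat.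
move=> /cvge_to_le; apply; apply: nearW => n.
by rewrite -law_cdfE lee_fin bu// ltrBlDr ltrDl invr_gt0.
Qed.

End law_cdf.

(** * Level sets of distribution functions and monotone pushforwards *)

Lemma negligible_countable_bigcup d (T : measurableType d) (R : realType)
    (mu : {measure set T -> \bar R}) (I : countType) (F : I -> set T) :
  (forall i, mu.-negligible (F i)) -> mu.-negligible (\bigcup_i F i).
Proof.
move=> F0; apply: (@negligibleS _ _ _ _ (\bigcup_n oapp F set0 (unpickle n))).
  by move=> x [i _ Fix]; exists (pickle i); rewrite ?pickleK.
by apply: negligible_bigcup => n; case: unpickle => [i|] //=; exact: negligible_set0.
Qed.

(* A point strictly inside the level interval lies in some [`]r, r']] with [r] and
   [r'] rational in that interval; its mass is [law_cdf a r' - law_cdf a r = 0]. *)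
Lemma negligible_law_cdf_level (R : realType) (a : probability R R) (u : R) :
  (forall c, a [set c] = 0%E) -> a.-negligible (law_cdf a @^-1` [set u]).
Proof.
move=> a0; set L := _ @^-1` _.
pose G (rr : rat * rat) : set R :=
  if (law_cdf a (ratr rr.1) == u) && (law_cdf a (ratr rr.2) == u)
  then `]ratr rr.1, ratr rr.2]%classic else set0.
(* The endpoints of the level set are not strictly between two of its points, so they are set aside
   as null singletons; for an unbounded level set a default [inf] or [sup] is just one more null
   point. *)
apply: (@negligibleS _ _ _ _ ([set inf L] `|` [set sup L] `|` \bigcup_rr G rr)).
  move=> s Ls; have [->|sinf] := eqVneq s (inf L); first by left; left.
  have [->|ssup] := eqVneq s (sup L); first by left; right.
  right.
  have between x y z : L x -> L y -> x <= z -> z <= y -> law_cdf a z == u.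
    move=> Lx Ly xz zy; rewrite eq_le -{1}Ly -Lx.
    by rewrite !law_cdf_nondecreasing.
  have [x Lx xs] : exists2 x, L x & x < s.
    apply: contrapT => noL; move/eqP: sinf; apply.
    have Ll : lbound L s.
      by move=> x Lx; rewrite leNgt; apply/negP => xs; apply: noL; exists x.
    by apply/eqP; rewrite eq_le lb_le_inf//=; [apply: ge_inf => //; exists s|exists s].
  have [y Ly sy] : exists2 y, L y & s < y.
    apply: contrapT => noL; move/eqP: ssup; apply.
    have Ll : ubound L s.
      by move=> y Ly; rewrite leNgt; apply/negP => sy; apply: noL; exists y.
    by apply/eqP; rewrite eq_le ge_sup//= ?andbT;
      [apply: ub_le_sup => //; exists s|exists s].
  have [r] := rat_in_itvoo xs; rewrite in_itv/= => /andP[xr rs].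
  have [r'] := rat_in_itvoo sy; rewrite in_itv/= => /andP[sr' r'y].
  exists (r, r') => //; rewrite /G/=.
  rewrite (between x s)// ?(between s y)//=; try exact: ltW.
  by rewrite in_itv/= rs ltW.
have set1_0 c : a.-negligible [set c]
  by exists [set c]; split=> //; exact: measurable_set1.
apply: negligibleU; first exact: negligibleU.
apply: negligible_countable_bigcup => -[r r'] /=; rewrite /G/=.
case: ifPn => [/andP[/eqP ru /eqP r'u]|_]; last exact: negligible_set0.
apply/negligibleP => //.
have [rr'|r'r] := leP (ratr r : R) (ratr r'); last first.
  by rewrite set_itv_ge// bnd_simp -leNgt ltW.
have -> : `]ratr r, ratr r']%classic = `]-oo, ratr r' : R] `\` `]-oo, ratr r].
  by rewrite -[RHS]setCK setCD setCitvl setUC -[LHS]setCK setCitv.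
rewrite measureD//= ?setIidr; last 2 first.
  by apply: subset_itvl; rewrite bnd_simp.
  by rewrite -law_cdfE ltry.
by rewrite -!law_cdfE ru r'u -EFinB subrr.
Qed.

(** The preimage of []-oo, f s]] exceeds []-oo, s]] only by points of the fibre of [f] over [f s],
    which is null. *)
Lemma law_cdf_pushforward (R : realType) (a : probability R R) (f : R -> R) (s : R) :
  nondecreasing_fun f -> pushforward a f [set f s] = 0%E ->
  law_cdf (pushforward a f) (f s) = law_cdf a s.
Proof.
move=> fnd fs0; congr fine.
have mf : measurable_fun setT f by exact: nondecreasing_measurable.
have mfs : measurable (f @^-1` [set f s]).
  by rewrite -[X in measurable X]setTI; apply: mf => //; exact: measurable_set1.
rewrite -[RHS](measureU0 _ mfs fs0)//; congr (a _).
apply/seteqP; split => t /=; rewrite !in_itv/=.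
  have [ts|st] := leP t s; [by left|right].
  by apply/eqP; rewrite eq_le; apply/andP; split=> //; exact/fnd/ltW.
by move=> [/fnd//|->].
Qed.

(* For [r] rational strictly between [quantile (pushforward b f) u] and
   [f (quantile b u)] one has [u <= b (f <= r) <= b (]-oo, quantile b u[) <= u];
   this is how the exceptional levels arise when [f] is not left-continuous. *)
Lemma quantile_pushforward (R : realType) (b : probability R R) (f : R -> R) (u : R) :
  nondecreasing_fun f -> 0 < u < 1 ->
  (forall r : rat, law_cdf (pushforward b f) (ratr r) != u) ->
  quantile (pushforward b f) u = f (quantile b u).
Proof.
move=> fnd u01 ur; set q := quantile b u.
have mf : measurable_fun setT f by exact: nondecreasing_measurable.
have mfle t : measurable (f @^-1` `]-oo, t]).
  by rewrite -[X in measurable X]setTI; exact: mf.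
have [b' b'E] := pushforward_probability b mf.
have b'cdf t : (law_cdf b' t)%:E = b (f @^-1` `]-oo, t]) by rewrite law_cdfE -b'E.
rewrite b'E in ur *.
apply/eqP; rewrite eq_le; apply/andP; split.
  rewrite quantile_galois// -lee_fin b'cdf.
  apply: (@le_trans _ _ (b `]-oo, q]%classic)).
    by rewrite -law_cdfE lee_fin -quantile_galois.
  apply: le_measure; rewrite ?inE// => s /=; rewrite !in_itv/=; exact: fnd.
rewrite leNgt; apply/negP => /rat_in_itvoo[r]; rewrite in_itv/= => /andP[ur' rq].
move: (ur r); apply/negP/negPn; rewrite eq_le -(quantile_galois b' _ u01) (ltW ur') andbT.
rewrite -lee_fin b'cdf; apply: (@le_trans _ _ (b `]-oo, q[%classic)).
  apply: le_measure; rewrite ?inE// => s /=; rewrite !in_itv/= => fsr.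
  rewrite ltNge; apply/negP => /fnd qs.
  by move: rq; rewrite ltNge (le_trans qs fsr).
apply: measure_itvNyo_le => s sq.
by rewrite leNgt; apply/negP => /ltW; rewrite -quantile_galois// leNgt sq.
Qed.

Lemma quantile_pushforward_ae (R : realType) (a b : probability R R) (f : R -> R) :
  (forall c, a [set c] = 0%E) -> nondecreasing_fun f ->
  a.-negligible [set t | quantile (pushforward b f) (law_cdf a t) <>
                         f (quantile b (law_cdf a t))].
Proof.
move=> a0 fnd.
pose L u := law_cdf a @^-1` [set u].
apply: (@negligibleS _ _ _ _
    (L 0 `|` L 1 `|` \bigcup_r L (law_cdf (pushforward b f) (ratr r)))).
  move=> t /= tE; apply: contrapT => /not_orP[/not_orP[/eqP F0 /eqP F1] Fr].
  apply: tE; apply: quantile_pushforward => //.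
    by rewrite !lt_neqAle eq_sym F0 F1 law_cdf_ge0 law_cdf_le1.
  by move=> r; apply/eqP => rF; apply: Fr; exists r.
apply: negligibleU; first by apply: negligibleU; exact: negligible_law_cdf_level.
by apply: negligible_countable_bigcup => r; exact: negligible_law_cdf_level.
Qed.

(** Both preimages become the same set once a measurable null set containing the disagreement is
    added to each. *)
Lemma measure_preimage_ae d d' (T : measurableType d) (T' : measurableType d')
    (R : realType) (mu : {measure set T -> \bar R}) (f g : T -> T') (A : set T') :
  measurable_fun setT f -> measurable_fun setT g ->
  mu.-negligible [set x | f x <> g x] -> measurable A ->
  mu (f @^-1` A) = mu (g @^-1` A).
Proof.
move=> mf mg [N [mN N0 fgN]] mA.
have mfA : measurable (f @^-1` A) by rewrite -[X in measurable X]setTI; exact: mf.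
have mgA : measurable (g @^-1` A) by rewrite -[X in measurable X]setTI; exact: mg.
rewrite -(measureU0 mfA mN N0) -(measureU0 mgA mN N0); congr (mu _).
apply/seteqP; split => x [Ax|]; try (by right);
  have [fgx|/fgN] := pselect (f x = g x); try (by right); left.
  by rewrite /preimage/= -fgx.
by rewrite /preimage/= fgx.
Qed.

Theorem proposition4p5 (R : realType) (n : nat)
    (sigma mu : set 'cV[R]_n -> \bar R) (P : 'M[R]_n) (T : 'cV[R]_n -> 'cV[R]_n)
    (hsigma : W2ac sigma) (hmu : W2 mu)
    (hP : orthogonal_group P) (hT : compatible_maps P T) :
  (W2ac (pushforward sigma T) ->
     eq_borel (slice_matching (pushforward sigma T) mu P)
              (slice_matching sigma mu P)) /\
  (W2 (pushforward mu T) ->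
     eq_borel (slice_matching sigma (pushforward mu T) P)
              (pushforward (slice_matching sigma mu P) T)).
Proof.
case: hT => f fnd <- {T}.
case: hsigma => -[[p pE] _] sigma_ac; case: hmu => -[m mE] _; subst sigma mu.
have sliceP (q : probability 'cV[R]_n R) i :
    {s : probability R R | slice (col i P) q = s :> (set R -> \bar R)}.
  by apply: cid; apply: pushforward_probability; exact: measurable_dotv.
pose a i := sval (sliceP p i); pose b i := sval (sliceP m i).
have aE i : slice (col i P) p = a i := svalP (sliceP p i).
have bE i : slice (col i P) m = b i := svalP (sliceP m i).
have mf i : measurable_fun setT (f i).
  by apply: nondecreasing_measurable => //; exact: fnd.
split=> [[_ Tsigma_ac] A mA | _ A mA].
  rewrite /slice_matching /pushforward; congr (p _).
  apply/seteqP.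
  suff slE x : slice_matching_map (pushforward p (separable_map P f)) m P
      (separable_map P f x) = slice_matching_map p m P x.
    by split => x /=; rewrite slE.
  rewrite /slice_matching_map separable_map_comp//.
  apply: eq_bigr => i _; congr (_ *: _).
  rewrite /ot_map /= slice_pushforward// aE law_cdf_pushforward//.
  (* Here it is the absolute continuity of the pushforward, not of [sigma], that excludes the
     atom. *)
  rewrite -aE -slice_pushforward//.
  by apply: slice_set1 => //; exact: col_orthogonal_neq0.
have a0 i c : a i [set c] = 0%E.
  by rewrite -aE; apply: slice_set1 => //; exact: col_orthogonal_neq0.
have mot (s : probability R R) i : measurable_fun setT (quantile s \o law_cdf (a i)).
  by apply: measurableT_comp; [exact: measurable_quantile|exact: measurable_law_cdf].
rewrite /slice_matching.
have -> : pushforward (pushforward p (slice_matching_map p m P)) (separable_map P f) A =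
    pushforward p (separable_map P (fun i => f i \o (quantile (b i) \o law_cdf (a i)))) A.
  rewrite /pushforward; congr (p _); apply/seteqP.
  suff slE x : separable_map P f (slice_matching_map p m P x) =
      separable_map P (fun i => f i \o (quantile (b i) \o law_cdf (a i))) x.
    by split => x /=; rewrite slE.
  rewrite separable_map_comp//; apply: eq_bigr => i _ /=.
  by rewrite aE bE.
have [b' b'E] : exists b' : 'I_n -> probability R R,
    forall i, pushforward (b i) (f i) = b' i :> (set R -> \bar R).
  have /(_ _)/cid bP i := pushforward_probability (b i) (mf i).
  by exists (fun i => sval (bP i)) => i; exact: svalP (bP i).
have -> : slice_matching_map p (pushforward m (separable_map P f)) P =
    separable_map P (fun i => quantile (b' i) \o law_cdf (a i)).
  apply/funext => x; apply: eq_bigr => i _.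
  by rewrite /ot_map/= slice_pushforward// aE bE b'E.
rewrite /pushforward; apply: measure_preimage_ae => //.
- by apply: measurable_separable_map => i; exact: mot.
- by apply: measurable_separable_map => i; apply: measurableT_comp => //; exact: mot.
pose N i := [set t | quantile (b' i) (law_cdf (a i) t) <>
  f i (quantile (b i) (law_cdf (a i) t))].
(* The two separable maps can differ at [x] only if some coordinate of [x] along a column of [P]
   lies in its exceptional set [N i]. *)
apply: (@negligibleS _ _ _ _ (\bigcup_i ((fun x => dotv x (col i P)) @^-1` N i))).
  move=> x /= xE; apply: contrapT => xN; apply: xE; apply: eq_bigr => i _ /=.
  by congr (_ *: _); apply: contrapT => xi; apply: xN; exists i.
apply: negligible_countable_bigcup => i.
have [B [mB B0 NB]] : (a i).-negligible (N i).
  by rewrite /N -b'E; apply: quantile_pushforward_ae => //; exact: fnd.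
(* As [a i] is the slice of [p], the [p]-measure of this cylinder is the [a i]-measure of [B]. *)
exists ((fun x => dotv x (col i P)) @^-1` B); split.
- by rewrite -[X in measurable X]setTI; exact: measurable_dotv.
- by rewrite -B0 -aE.
- by move=> x; exact: NB.
Qed.
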